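(* Let $D\subseteq\mathbb{R}^n$ be a nonempty closed set of nonzero vectors. Suppose that $\operatorname{pspan}(D)\neq\operatorname{span}(D)$. Then $\operatorname{cm}_D(D)=0$ if and only if $D$ contains a nonempty finite proper subset $V$ such that $\operatorname{pspan}(V)=\operatorname{span}(V)$.
   Context: $\operatorname{span}(D)$ is the set of finite linear combinations of elements of $D$, and $\operatorname{pspan}(D)=\{\sum_{i=1}^k\lambda_i d_i: k\in\mathbb{N}, d_i\in D,\lambda_i\ge 0\}$. The cosine measure of $D$ relative to $\operatorname{span}(D)$ is $$\operatorname{cm}_D(D)=\min_{u\in\operatorname{span}(D),\ \|u\|=1}\ \sup_{d\in D}\frac{u^\top d}{\|d\|}.$$
   Formalization: The set of directions d/‖d‖, d ∈ D, is also assumed closed (automatic for compact D or closed sets of unit vectors); without this the claim fails, e.g. for D = {(x,1) : x ∈ ℝ} in ℝ², where cm_D(D) = 0 but no such V exists. *)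

(* Defs.v *)
From mathcomp Require Import all_boot all_order all_algebra.
From mathcomp Require Import all_classical all_reals all_analysis.
Set Implicit Arguments.
Unset Strict Implicit.
Unset Printing Implicit Defensive.
Import Order.TTheory GRing.Theory Num.Theory numFieldNormedType.Exports.
Local Open Scope classical_set_scope.
Local Open Scope ring_scope.

Section CosineMeasure.
Context {R : realType} {n : nat}.
Implicit Types (u d x : 'cV[R]_n) (D : set 'cV[R]_n).

Definition dotv u d : R := (u^T *m d) 0 0.

(* The library norm on matrices is the max norm, hence this definition; the
   library topology on 'cV[R]_n is nevertheless the usual one. *)
Definition enorm u : R := Num.sqrt (dotv u u).

(* Cosine measure and (positive) spans depend on D only through its directions,
   but closedness does not: D = {(x, 1)} in R^2 is closed, its set of directions
   (the open upper half circle) is not. For that D the supremum of cosines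
   against u = (0, -1) is 0, is not attained, and is the cosine measure of D,
   although no finite nonempty V in D satisfies pspan V = lspan V. Closedness of
   direction @` D excludes this; it holds for closed sets of unit vectors and
   for compact (e.g. finite) sets of nonzero vectors. *)
Definition direction d : 'cV[R]_n := (enorm d)^-1 *: d.

Definition lspan D : set 'cV[R]_n :=
  [set x | exists (k : nat) (d : 'I_k -> 'cV[R]_n) (c : 'I_k -> R),
     (forall i, D (d i)) /\ x = \sum_(i < k) c i *: d i].

Definition pspan D : set 'cV[R]_n :=
  [set x | exists (k : nat) (d : 'I_k -> 'cV[R]_n) (c : 'I_k -> R),
     (forall i, D (d i) /\ 0 <= c i) /\ x = \sum_(i < k) c i *: d i].

(* For a nonempty set D of nonzero vectors the cosines lie in [-1, 1], so the
   real-valued sup is the actual supremum. *)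
Definition max_cosine D u : R := sup [set dotv u d / enorm d | d in D].

(* is_cosine_measure D c: the minimum of max_cosine D over the unit vectors of
   lspan D exists and equals c. *)
Definition is_cosine_measure D (c : R) : Prop :=
  let values := [set max_cosine D u | u in [set u | lspan D u /\ enorm u = 1]] in
  values c /\ lbound values c.

End CosineMeasure.

(* Main.v *)
Require Import Defs.
From mathcomp Require Import all_boot all_order all_algebra.
From mathcomp Require Import all_classical all_reals all_analysis.
From mathcomp Require Import lra.
Import Order.TTheory GRing.Theory Num.Theory numFieldNormedType.Exports.
Local Open Scope classical_set_scope.
Local Open Scope ring_scope.

(** Let E be the set of directions of D: a compact subset of the unit sphere.
    Everything rests on one fact (min_norm_hull): the convex hull of E has a
    point p with p.p <= p.e for all e in E. The work lies in getting this from
    combinations of n + 1 points only, which form a compact family. Take such a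
    combination of least norm. If all its weights are positive and p is not 0,
    its n + 1 points lie on the hyperplane p.x = p.p; they are linearly
    dependent, and the dependence, whose coefficients sum to 0, can be used to
    cancel one weight (caratheodory_step). The freed slot can then receive any
    e in E, and minimality along the segment from p to e gives the inequality.

    If the cosine measure is 0, then p must be 0, for otherwise all cosines of
    the direction of - p would be bounded by a negative number. So 0 is a convex
    combination of directions; the vectors of D that carry a positive weight
    form a finite V, and solving the relation for each of them shows that
    pspan V contains - V, hence equals lspan V (pspan_eq_lspan_relation). V is
    not D, because D does not have this property.

    Conversely, a V with pspan V = lspan V meets every closed half-space
    u.x >= 0: otherwise u.v < 0 for some v in V, while - v in pspan V gives
    u.(- v) <= 0. So max_cosine D u >= 0 for every unit u. The value 0 is
    attained because the cone pspan D, being different from lspan D, is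
    contained in a half-space with unit normal in lspan D (pspan_separation).
    The cone need not be closed, so this does not follow by projecting onto it.
    Instead, for x in lspan D outside pspan D and small t > 0, the point t x is
    not in the hull of E; projecting it on the hull gives a unit w in lspan D
    with w.e <= t |x| on E, and compactness of the unit sphere of lspan D
    provides a limit of these w as t tends to 0. *)

(** * The Euclidean inner product *)

Section DotProduct.
Set Implicit Arguments.
Unset Strict Implicit.
Unset Printing Implicit Defensive.
Context {R : realType} {n : nat}.
Implicit Types (u v w x : 'cV[R]_n) (a : R).

Lemma dotvE u v : dotv u v = \sum_i u i 0 * v i 0.
Proof. by rewrite /dotv mxE; apply: eq_bigr => i _; rewrite mxE. Qed.

Lemma dotvC u v : dotv u v = dotv v u.
Proof. by rewrite !dotvE; apply: eq_bigr => i _; rewrite mulrC. Qed.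

Lemma dotvDr u v w : dotv u (v + w) = dotv u v + dotv u w.
Proof. by rewrite /dotv mulmxDr mxE. Qed.

Lemma dotvZr u a v : dotv u (a *: v) = a * dotv u v.
Proof. by rewrite /dotv -scalemxAr mxE. Qed.

Lemma dotvNr u v : dotv u (- v) = - dotv u v.
Proof. by rewrite -scaleN1r dotvZr mulN1r. Qed.

Lemma dotv0r u : dotv u 0 = 0.
Proof. by rewrite -(scale0r 0) dotvZr mul0r. Qed.

Lemma dotvDl u v w : dotv (v + w) u = dotv v u + dotv w u.
Proof. by rewrite dotvC dotvDr !(dotvC u). Qed.

Lemma dotvZl u a v : dotv (a *: v) u = a * dotv v u.
Proof. by rewrite dotvC dotvZr dotvC. Qed.

Lemma dotvNl u v : dotv (- v) u = - dotv v u.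
Proof. by rewrite dotvC dotvNr dotvC. Qed.

Lemma dotv_sumr u (I : finType) (P : pred I) (d : I -> 'cV[R]_n) (c : I -> R) :
  dotv u (\sum_(i | P i) c i *: d i) = \sum_(i | P i) c i * dotv u (d i).
Proof.
rewrite (big_morph (dotv u) (dotvDr u) (dotv0r u)).
by apply: eq_bigr => i _; rewrite dotvZr.
Qed.

Lemma dotv_ge0 u : 0 <= dotv u u.
Proof. by rewrite dotvE sumr_ge0 // => i _; rewrite -expr2 sqr_ge0. Qed.

Lemma dotv_eq0 u : (dotv u u == 0) = (u == 0).
Proof.
apply/eqP/eqP => [|->]; last exact: dotv0r.
rewrite dotvE => /eqP; rewrite psumr_eq0 => [/allP u0|i _]; last first.
  by rewrite -expr2 sqr_ge0.
apply/colP => i; rewrite mxE; apply/eqP.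
by have := u0 i (mem_index_enum i); rewrite /= -expr2 sqrf_eq0.
Qed.

Lemma dotv_gt0 u : (0 < dotv u u) = (u != 0).
Proof. by rewrite lt_neqAle dotv_ge0 andbT eq_sym dotv_eq0. Qed.

Lemma enorm_gt0 u : (0 < enorm u) = (u != 0).
Proof. by rewrite sqrtr_gt0 dotv_gt0. Qed.

Lemma enormK u : enorm u ^+ 2 = dotv u u.
Proof. by rewrite sqr_sqrtr // dotv_ge0. Qed.

Lemma enorm_direction u : u != 0 -> enorm (direction u) = 1.
Proof.
move=> u0; rewrite /enorm dotvZl dotvZr -enormK mulrA -expr2 -exprMn.
by rewrite mulVf ?expr1n ?sqrtr1 // gt_eqF ?enorm_gt0.
Qed.

Lemma dotv_direction u v : dotv u (direction v) = dotv u v / enorm v.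
Proof. by rewrite dotvZr mulrC. Qed.

Lemma le_coord_enorm u i : `|u i 0| <= enorm u.
Proof.
rewrite -sqrtr_sqr ler_sqrt ?dotv_ge0 // dotvE (bigD1 i) //= -expr2 lerDl.
by rewrite sumr_ge0 // => j _; rewrite -expr2 sqr_ge0.
Qed.

Lemma dotv_unit_le1 u v : enorm u = 1 -> enorm v = 1 -> dotv u v <= 1.
Proof.
move=> u1 v1; have := dotv_ge0 (u - v).
rewrite dotvDl !dotvDr !dotvNl !dotvNr (dotvC v u) -!enormK u1 v1 expr1n.
lra.
Qed.

(** First-order condition: with a = p.p - p.q and b = |q - p|^2, the squared
    norm changes by t (t b - 2 a) along the segment, which is negative for small
    t > 0 when a > 0. *)
Lemma segment_min_dotv (p q : 'cV[R]_n) :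
  (forall t : R, 0 <= t <= 1 ->
     dotv p p <= dotv (p + t *: (q - p)) (p + t *: (q - p))) ->
  dotv p p <= dotv p q.
Proof.
move=> pmin; rewrite leNgt; apply/negP => pq.
set a := dotv p p - dotv p q; set b := dotv (q - p) (q - p).
have a0 : 0 < a by rewrite subr_gt0.
have b0 : 0 <= b := dotv_ge0 _.
have ab : 0 < a + b by lra.
(* This t satisfies t b < 2 a and lies in [0, 1] even when b = 0. *)
have /pmin : 0 <= a / (a + b) <= 1.
  by rewrite divr_ge0 ?(ltW a0) ?(ltW ab) //= ler_pdivrMr // mul1r; lra.
set t := a / (a + b).
have t0 : 0 < t by rewrite divr_gt0.
have tab : t * (a + b) = a by rewrite /t divfK // gt_eqF.
rewrite dotvDl !(dotvDr _ p) !dotvZl !dotvZr (dotvC (q - p) p) -/b.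
rewrite dotvDr dotvNr.
have -> : dotv p q - dotv p p = - a by rewrite /a opprB.
have tb : t * (t * b) = t * a - t * (t * a).
  by apply/eqP; rewrite eq_sym subr_eq -!mulrDr (addrC b) tab.
have := mulr_gt0 t0 (mulr_gt0 t0 a0); have := mulr_gt0 t0 a0.
clearbody t; lra.
Qed.

End DotProduct.

(** * Closest points of convex hulls *)

Section ConvexHull.
Set Implicit Arguments.
Unset Strict Implicit.
Unset Printing Implicit Defensive.
Context {R : realType}.

Definition weights {k} (c : 'I_k -> R) : Prop :=
  (forall i, 0 <= c i) /\ \sum_i c i = 1.

Definition convex_hull {n} (E : set 'cV[R]_n) : set 'cV[R]_n :=
  [set x | exists (k : nat) (d : 'I_k -> 'cV[R]_n) (c : 'I_k -> R),
     [/\ forall i, E (d i), weights c & x = \sum_i c i *: d i]].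

Lemma weights_segment k (c c' : 'I_k -> R) t : weights c -> weights c' ->
  0 <= t <= 1 -> weights (fun i => (1 - t) * c i + t * c' i).
Proof.
move=> [c0 c1] [c'0 c'1] /andP[t0 t1]; split=> [i|].
  by rewrite addr_ge0 // mulr_ge0 // subr_ge0.
by rewrite big_split -!mulr_sumr /= c1 c'1 !mulr1 subrK.
Qed.

Lemma weights_delta k (j : 'I_k) : weights (fun i => (i == j)%:R).
Proof.
split=> [i|]; first exact: ler0n.
by rewrite (bigD1 j) //= eqxx big1 ?addr0 // => i /negPf->.
Qed.

Lemma sum_delta n k (d : 'I_k -> 'cV[R]_n) j :
  \sum_i (i == j)%:R *: d i = d j.
Proof.
rewrite (bigD1 j) //= eqxx scale1r big1 ?addr0 // => i /negPf->.
by rewrite scale0r.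
Qed.

(** Apply the first-order condition to the segments from p to the vertices of
    the simplex, which stay among the combinations of the d i. *)
Lemma weights_min_vertex n k (d : 'I_k -> 'cV[R]_n) (c : 'I_k -> R) p :
  weights c -> p = \sum_i c i *: d i ->
  (forall c' : 'I_k -> R, weights c' ->
     dotv p p <= dotv (\sum_i c' i *: d i) (\sum_i c' i *: d i)) ->
  forall j, dotv p p <= dotv p (d j).
Proof.
move=> cw pE pmin j; apply: segment_min_dotv => t t01.
suff -> : p + t *: (d j - p) =
    \sum_i ((1 - t) * c i + t * (i == j)%:R) *: d i.
  by apply: pmin; apply: weights_segment => //; exact: weights_delta.
under [RHS]eq_bigr => i _ do rewrite scalerDl -!scalerA.
rewrite big_split -!scaler_sumr /= -pE sum_delta.
by rewrite scalerBr scalerBl scale1r addrA addrAC.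
Qed.

Lemma linear_relation n (d : 'I_n.+1 -> 'cV[R]_n) :
  exists2 a : 'I_n.+1 -> R, exists j, a j != 0 & \sum_i a i *: d i = 0.
Proof.
pose A : 'M[R]_(n.+1, n) := \matrix_i (d i)^T.
have : kermx A != 0.
  rewrite kermx_eq0 /row_free; apply: contraTneq (rank_leq_col A) => ->.
  by rewrite ltnn.
move=> /rowV0Pn [v /sub_kermxP vA v0].
exists (fun i => v 0 i).
  by move: v0 => /rV0Pn.
apply: trmx_inj; rewrite trmx0 -[RHS]vA mulmx_sum_row linear_sum.
by apply: eq_bigr => i _; rewrite linearZ /= rowK.
Qed.

(** A relation \sum a i d i = 0 satisfies \sum a i = 0, because pairing it with
    u gives b \sum a i = 0. So c - t a remains a weight vector with the same
    combination as t grows from 0, until a first entry vanishes; that happens at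
    the least ratio c i / a i with a i > 0. *)
Lemma caratheodory_step n (d : 'I_n.+1 -> 'cV[R]_n) (c : 'I_n.+1 -> R) u b :
  weights c -> b != 0 -> (forall i, dotv u (d i) = b) ->
  exists c' : 'I_n.+1 -> R, [/\ weights c', exists j, c' j = 0 &
    \sum_i c' i *: d i = \sum_i c i *: d i].
Proof.
move=> [c0 c1] b0 db.
have [a [j aj0] ad] := linear_relation d.
have a0 : \sum_i a i = 0.
  apply: (mulIf b0); rewrite mul0r -[RHS](dotv0r u) -ad dotv_sumr mulr_suml.
  by apply: eq_bigr => i _; rewrite db.
have [i0 ai0] : exists i0, 0 < a i0.
  apply/existsP; rewrite -[X in is_true X]negbK negb_exists.
  apply: contra aj0 => /forallP an.
  have an0 i : 0 <= - a i by rewrite oppr_ge0 leNgt an.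
  have /eqP : \sum_i - a i = 0 by rewrite sumrN a0 oppr0.
  rewrite psumr_eq0 // => /allP /(_ j (mem_index_enum j)) /=.
  by rewrite oppr_eq0.
case: (@arg_minP _ _ _ i0 (fun i => 0 < a i) (fun i => c i / a i) ai0).
move=> m am mmin; pose t := c m / a m.
have t0 : 0 <= t by rewrite divr_ge0 // ltW.
exists (fun i => c i - t * a i); split.
- split=> [i|]; last by rewrite sumrB -mulr_sumr a0 mulr0 subr0.
  rewrite subr_ge0; have [ai|ai] := ltP 0 (a i).
    by rewrite -ler_pdivlMr // mmin.
  by rewrite (le_trans _ (c0 i)) // mulr_ge0_le0.
- by exists m; rewrite /t divfK ?subrr // gt_eqF.
- under eq_bigr => i _ do rewrite scalerBl -scalerA.
  by rewrite sumrB -scaler_sumr ad scaler0 subr0.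
Qed.

Lemma continuous_dotv (T : topologicalType) n (f g : T -> 'cV[R]_n) :
  continuous f -> continuous g -> continuous (fun t => dotv (f t) (g t)).
Proof.
move=> cf cg; under eq_fun do rewrite dotvE.
apply: continuous_big => [|i _ t]; first exact: add_continuous.
by apply: cvgM; apply: (@continuous_comp _ _ _ _ (fun x : 'cV[R]_n => x i 0) t);
  [exact: cf|exact: coord_continuous|exact: cg|exact: coord_continuous].
Qed.

Lemma continuous_comb (T : topologicalType) n k
    (c : 'I_k -> T -> R) (d : 'I_k -> T -> 'cV[R]_n) :
  (forall i, continuous (c i)) -> (forall i, continuous (d i)) ->
  continuous (fun t => \sum_i c i t *: d i t).
Proof.
move=> cc cd; apply: continuous_big => [|i _ t]; first exact: add_continuous.
by apply: cvgZ; [exact: cc|exact: cd].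
Qed.

(** The number of points is fixed so that the pairs (weights, points) range over
    a compact set, a closed part of a power of [0, 1] x E, where the squared
    norm attains its minimum. *)
Lemma closest_combination n (E : set 'cV[R]_n) k : E !=set0 -> compact E ->
  exists (d : 'I_k.+1 -> 'cV[R]_n) (c : 'I_k.+1 -> R),
    [/\ forall i, E (d i), weights c &
     forall (d' : 'I_k.+1 -> 'cV[R]_n) (c' : 'I_k.+1 -> R),
       (forall i, E (d' i)) -> weights c' ->
       dotv (\sum_i c i *: d i) (\sum_i c i *: d i) <=
       dotv (\sum_i c' i *: d' i) (\sum_i c' i *: d' i)].
Proof.
move=> [e0 Ee0] Ec.
pose T := prod_topology (fun _ : 'I_k.+1 => (R * 'cV[R]_n)%type).
pose B : set T := [set f | forall i, (`[0, 1] `*` E) (f i)].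
have Bc : compact B.
  apply: (@tychonoff _ (fun _ : 'I_k.+1 => (R * 'cV[R]_n)%type)
    (fun=> `[0, 1] `*` E)) => i.
  by apply: compact_setX => //; exact: segment_compact.
pose S : set T := [set f | \sum_i (f i).1 = 1].
have c1 i : continuous (fun f : T => (f i).1).
  move=> f; apply: (@cvg_comp _ _ _ (fun f : T => f i) fst).
    exact: (@proj_continuous _ (fun _ : 'I_k.+1 => (R * 'cV[R]_n)%type) i f).
  exact: cvg_fst.
have c2 i : continuous (fun f : T => (f i).2).
  move=> f; apply: (@cvg_comp _ _ _ (fun f : T => f i) snd).
    exact: (@proj_continuous _ (fun _ : 'I_k.+1 => (R * 'cV[R]_n)%type) i f).
  exact: cvg_snd.
have Sc : closed S.
  apply: (@preimage_closed _ _ (fun f : T => \sum_i (f i).1) [set x | x = 1]).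
    move=> f _; apply: continuous_big => //; exact: add_continuous.
  exact: closed_eq.
have cx : continuous (fun f : T => \sum_i (f i).1 *: (f i).2).
  exact: continuous_comb c1 c2.
have cm := continuous_dotv cx cx.
have BSc : compact (B `&` S) by exact: compact_closedI.
have wB (d : 'I_k.+1 -> 'cV[R]_n) (c : 'I_k.+1 -> R) : (forall i, E (d i)) ->
    weights c -> (B `&` S) (fun i => (c i, d i)).
  move=> Ed [cc0 cc1]; split => // i; split => //=.
  rewrite in_itv /= cc0 -cc1 (bigD1 i) //= lerDl.
  by rewrite sumr_ge0.
have [|f + fmin] := @compact_EVT_min T R _ _ _ BSc (continuous_subspaceT cm).
  exists (fun i => ((i == ord0)%:R, e0)); apply: wB => //.
  exact: weights_delta.
rewrite inE => -[fB fS].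
exists (fun i => (f i).2), (fun i => (f i).1); split.
- by move=> i; case: (fB i).
- by split=> // i; case: (fB i) => /= + _; rewrite in_itv /= => /andP[].
- move=> d' c' Ed' wc'; apply: (fmin (fun i => (c' i, d' i))).
  by rewrite inE; exact: wB.
Qed.

(** The variational inequality for the projection of 0 on the hull. The number
    n + 1 of points is the least for which every family is linearly
    dependent. *)
Lemma min_norm_hull n (E : set 'cV[R]_n) : E !=set0 -> compact E ->
  exists2 p, convex_hull E p & forall e, E e -> dotv p p <= dotv p e.
Proof.
move=> E0 Ec; have [d [c [Ed wc mn]]] := closest_combination n E0 Ec.
set p := \sum_i c i *: d i in mn.
exists p; first by exists n.+1, d, c.
move=> e Ee; have [->|p0] := eqVneq p 0; first by rewrite !(dotvC 0) !dotv0r.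
have dp i : dotv p p <= dotv p (d i).
  by apply: (weights_min_vertex wc) => // c' wc'; exact: mn.
(* Some weight can be taken to be 0: when all are positive, the weighted mean
   of the nonnegative gaps dotv p (d i) - dotv p p is 0, so each gap is 0. *)
have [c' [wc' [j c'j] c'p]] : exists c' : 'I_n.+1 -> R,
    [/\ weights c', exists j, c' j = 0 & \sum_i c' i *: d i = p].
  have [/existsP[j /eqP cj]|cn0] := boolP [exists j, c j == 0].
    by exists c; split=> //; exists j.
  apply: (@caratheodory_step _ _ _ p (dotv p p)) => //.
    by rewrite dotv_eq0.
  move=> i; apply/eqP; rewrite -subr_eq0.
  have /eqP : \sum_i c i * (dotv p (d i) - dotv p p) = 0.
    under eq_bigr => l _ do rewrite mulrBr.
    rewrite sumrB -dotv_sumr -/p -mulr_suml; case: wc => _ ->.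
    by rewrite mul1r subrr.
  rewrite psumr_eq0 => [|l _]; last first.
    by rewrite mulr_ge0 ?subr_ge0 //; case: wc.
  move=> /allP /(_ i (mem_index_enum i)) /=; rewrite mulf_eq0 => /orP[ci|//].
  by case/existsP: cn0; exists i.
(* Replacing the point of weight 0 by e does not change p. *)
pose d' i := if i == j then e else d i.
have Ed' i : E (d' i) by rewrite /d'; case: ifP.
have pE : p = \sum_i c' i *: d' i.
  rewrite -c'p; apply: eq_bigr => i _; rewrite /d'.
  by case: eqP => // ->; rewrite c'j !scale0r.
have -> : e = d' j by rewrite /d' eqxx.
by apply: (weights_min_vertex wc' pE) => c'' wc''; exact: mn.
Qed.

Lemma nearest_hull n (E : set 'cV[R]_n) x : E !=set0 -> compact E ->
  exists2 p, convex_hull E p &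
    forall e, E e -> dotv (p - x) (p - x) <= dotv (p - x) (e - x).
Proof.
move=> [e0 Ee0] Ec.
have [||_ [k [d [c [Ed wc ->]]]] pmin] :=
    @min_norm_hull n ((fun e => e - x) @` E).
- by exists (e0 - x), e0.
- apply: continuous_compact => //; apply: continuous_subspaceT => e.
  apply: (@continuousB _ _ _ id (cst x)).
    by move=> A.
  exact: cst_continuous.
have /choice[d' Ed'] i : exists e, E e /\ e - x = d i.
  by have [e Ee <-] := Ed i; exists e.
have pE : \sum_i c i *: d i = \sum_i c i *: d' i - x.
  under eq_bigr => i _ do rewrite -(Ed' i).2 scalerBr.
  by rewrite sumrB -scaler_suml; case: wc => _ ->; rewrite scale1r.
exists (\sum_i c i *: d' i).
  by exists k, d', c; split=> // i; case: (Ed' i).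
by move=> e Ee; rewrite -pE; apply: pmin; exists e.
Qed.

End ConvexHull.

(** * Linear and positive spans *)

Section Spans.
Set Implicit Arguments.
Unset Strict Implicit.
Unset Printing Implicit Defensive.
Context {R : realType} {n : nat}.
Implicit Types (D V : set 'cV[R]_n) (x y w : 'cV[R]_n).

(** The common shape of lspan (Q d c := D d) and pspan (Q d c := D d and
    0 <= c), so that closure properties are proved once for both. *)
Definition span_of (Q : 'cV[R]_n -> R -> Prop) : set 'cV[R]_n :=
  [set x | exists (k : nat) (d : 'I_k -> 'cV[R]_n) (c : 'I_k -> R),
     (forall i, Q (d i) (c i)) /\ x = \sum_(i < k) c i *: d i].

Lemma span_of0 Q : span_of Q 0.
Proof.
by exists 0%N, (fun=> 0), (fun=> 0); split=> [[]//|]; rewrite big_ord0.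
Qed.

Lemma span_ofD Q x y : span_of Q x -> span_of Q y -> span_of Q (x + y).
Proof.
move=> [k [d [c [Qd ->]]]] [l [e [b [Qe ->]]]].
exists (k + l)%N.
exists (fun i => match fintype.split i with inl j => d j | inr j => e j end).
exists (fun i => match fintype.split i with inl j => c j | inr j => b j end).
split=> [i|]; first by case: (fintype.split i).
rewrite big_split_ord; congr (_ + _); apply: eq_bigr => i _ /=.
  by rewrite (unsplitK (inl i : 'I_k + 'I_l)%type).
by rewrite (unsplitK (inr i : 'I_k + 'I_l)%type).
Qed.

Lemma span_of_sum Q (I : finType) (P : pred I) (f : I -> 'cV[R]_n) :
  (forall i, P i -> span_of Q (f i)) -> span_of Q (\sum_(i | P i) f i).
Proof.
by move=> Qf; elim/big_ind: _ => //; [exact: span_of0|exact: span_ofD].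
Qed.

Lemma span_ofZ (Q Q' : 'cV[R]_n -> R -> Prop) a x :
  (forall d c, Q d c -> Q' d (a * c)) -> span_of Q x -> span_of Q' (a *: x).
Proof.
move=> QQ' [k [d [c [Qd ->]]]]; exists k, d, (fun i => a * c i).
split=> [i|]; first exact: QQ'.
by rewrite scaler_sumr; apply: eq_bigr => i _; rewrite scalerA.
Qed.

Lemma span_of1 (Q : 'cV[R]_n -> R -> Prop) c d : Q d c -> span_of Q (c *: d).
Proof.
by exists 1%N, (fun=> d), (fun=> c); split=> //; rewrite big_ord1.
Qed.

Lemma pspanE D : pspan D = span_of (fun d c => D d /\ 0 <= c).
Proof. by []. Qed.

Lemma lspanE D : lspan D = span_of (fun d _ => D d).
Proof. by []. Qed.

Lemma pspan0 D : pspan D 0.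
Proof. by rewrite pspanE; exact: span_of0. Qed.

Lemma pspan_sum D (I : finType) (P : pred I) (f : I -> 'cV[R]_n) :
  (forall i, P i -> pspan D (f i)) -> pspan D (\sum_(i | P i) f i).
Proof. by rewrite pspanE; exact: span_of_sum. Qed.

Lemma pspanZ D a x : 0 <= a -> pspan D x -> pspan D (a *: x).
Proof.
rewrite pspanE => a0; apply: span_ofZ => d c [Dd c0].
by split=> //; exact: mulr_ge0.
Qed.

Lemma sub_pspan D d : D d -> pspan D d.
Proof. by move=> Dd; rewrite pspanE -(scale1r d); apply: span_of1. Qed.

Lemma lspanD D x y : lspan D x -> lspan D y -> lspan D (x + y).
Proof. by rewrite lspanE; exact: span_ofD. Qed.

Lemma lspanZ D a x : lspan D x -> lspan D (a *: x).
Proof. by rewrite lspanE; exact: span_ofZ. Qed.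

Lemma lspanN D x : lspan D x -> lspan D (- x).
Proof. by rewrite -scaleN1r; exact: lspanZ. Qed.

Lemma pspan_sub_lspan D : pspan D `<=` lspan D.
Proof.
by move=> _ [k [d [c [Dd ->]]]]; exists k, d, c; split=> // i; case: (Dd i).
Qed.

Lemma pspan_eq_lspan D :
  (forall d, D d -> pspan D (- d)) -> pspan D = lspan D.
Proof.
move=> DN; apply/seteqP; split; first exact: pspan_sub_lspan.
move=> _ [k [d [c [Dd ->]]]]; apply: pspan_sum => i _.
have [ci|ci] := leP 0 (c i); first by apply: pspanZ => //; exact: sub_pspan.
rewrite -[_ *: _]opprK -scaleNr -scalerN.
by apply: pspanZ; [rewrite oppr_ge0 ltW|exact: DN].
Qed.

(** As D may be infinite, finitely many of its members that span it are found by
    maximizing the rank of a matrix with rows in D. *)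
Lemma lspan_max_rank D : exists k (A : 'M[R]_(k, n)),
  (forall i, D (row i A)^T) /\ forall d, D d -> (d^T <= A)%MS.
Proof.
pose P r := `[< exists k (A : 'M[R]_(k, n)),
  (forall i, D (row i A)^T) /\ \rank A = r >].
have P0 : exists r, P r.
  exists 0%N; apply/asboolP; exists 0%N, 0; split; first by case.
  by rewrite mxrank0.
have Pn r : P r -> (r <= n)%N.
  by move=> /asboolP[k [A [_ <-]]]; exact: rank_leq_col.
case: (ex_maxnP P0 Pn) => r /asboolP[k [A [DA rA]]] rmax.
exists k, A; split=> // d Dd.
have sAd : (A <= col_mx A d^T)%MS by rewrite -addsmxE addsmxSl.
have : P (\rank (col_mx A d^T)).
  apply/asboolP; exists (k + 1)%N, (col_mx A d^T); split=> // i.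
  rewrite -(splitK i); case: (fintype.split i) => j /=.
    by rewrite rowKu.
  by rewrite rowKd row_id trmxK.
move=> /rmax; rewrite -rA => rle.
have := mxrank_leqif_sup sAd => /leqifP; case: ifP => [sub _|_]; last first.
  by rewrite ltnNge rle.
by apply: submx_trans sub; rewrite -addsmxE addsmxSr.
Qed.

(** A linear span is its own double orthogonal complement; this describes it by
    linear equations, hence as a closed set. *)
Lemma lspanP D x :
  lspan D x <-> forall w, (forall d, D d -> dotv w d = 0) -> dotv w x = 0.
Proof.
split=> [[k [d [c [Dd ->]]]] w wD|xD].
  by rewrite dotv_sumr big1 // => i _; rewrite wD ?mulr0.
have [k [A [DA sDA]]] := lspan_max_rank D.
suff /submxP[c xE] : (x^T <= A)%MS.
  exists k, (fun i => (row i A)^T), (fun i => c 0 i); split=> //.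
  apply: trmx_inj; rewrite xE mulmx_sum_row linear_sum.
  by apply: eq_bigr => i _; rewrite linearZ /= trmxK.
rewrite submxE; apply/eqP/rowP => j.
have dotj y : dotv (col j (cokermx A)) y = (y^T *m cokermx A) 0 j.
  by rewrite dotvC /dotv !mxE; apply: eq_bigr => l _; rewrite !mxE.
rewrite [RHS]mxE -dotj; apply: xD => d Dd; rewrite dotj.
by have := sDA _ Dd; rewrite submxE => /eqP->; rewrite mxE.
Qed.

Lemma closed_lspan D : closed (lspan D).
Proof.
have -> : lspan D = \bigcap_(w in [set w | forall d, D d -> dotv w d = 0])
    [set x | dotv w x = 0].
  by apply/seteqP; split=> x; rewrite lspanP.
apply: closed_bigI => w _.
apply: (@preimage_closed _ _ (dotv w) [set x | x = 0]); last exact: closed_eq.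
move=> x _; apply: (@continuous_dotv R _ n (cst w) id) => //.
- exact: cst_continuous.
- by move=> y A.
Qed.

(** The box is the image of a power of [-1, 1], compact by Tychonoff's theorem,
    under the map sending coordinates to vectors. *)
Lemma compact_box : compact [set u : 'cV[R]_n | forall i, `|u i 0| <= 1].
Proof.
pose T := prod_topology (fun _ : 'I_n => R : Type).
pose B : set T := [set f | forall i, `[-1, 1]%classic (f i)].
have Bc : compact B.
  apply: (@tychonoff _ (fun _ : 'I_n => R) (fun=> `[-1, 1]%classic)) => i.
  exact: segment_compact.
pose g (f : T) : 'cV[R]_n := \sum_i f i *: delta_mx i 0.
have gE f i : g f i 0 = f i.
  rewrite /g summxE (bigD1 i) //= !mxE !eqxx mulr1 big1 ?addr0 // => j ji.
  by rewrite !mxE eq_sym (negPf ji) mulr0.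
have gc : continuous g.
  apply: (@continuous_comb R T n n (fun i f => f i)
    (fun i => cst (delta_mx i 0))) => i.
    exact: (@proj_continuous _ (fun _ : 'I_n => R : topologicalType) i).
  exact: cst_continuous.
have -> : [set u : 'cV[R]_n | forall i, `|u i 0| <= 1] = g @` B.
  apply/seteqP; split=> [u u1|_ [f Bf <-] i]; last first.
    by rewrite gE ler_norml; have := Bf i; rewrite /= in_itv.
  exists (fun i => u i 0) => [i|]; first by rewrite /= in_itv /= -ler_norml.
  by apply/colP => i; rewrite gE.
by apply: continuous_compact => //; exact: continuous_subspaceT.
Qed.

Lemma compact_sphere : compact [set u : 'cV[R]_n | enorm u = 1].
Proof.
apply: subclosed_compact compact_box _.
  have -> : [set u : 'cV[R]_n | enorm u = 1] =
      (fun u => dotv u u) @^-1` [set 1].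
    apply/seteqP; split=> u /= u1; first by rewrite -enormK u1 expr1n.
    by rewrite /enorm u1 sqrtr1.
  apply: (@preimage_closed _ _ (fun u : 'cV[R]_n => dotv u u) [set x | x = 1]).
    by move=> x _; apply: continuous_dotv => y A.
  exact: closed_eq.
by move=> u /= u1 i; rewrite -u1 le_coord_enorm.
Qed.

Lemma hull_sub_pspan D : convex_hull (direction @` D) `<=` pspan D.
Proof.
move=> _ [k [d [c [Dd [c0 _] ->]]]]; apply: pspan_sum => i _.
apply: pspanZ => //; have [e De <-] := Dd i.
by apply: pspanZ; [rewrite invr_ge0 sqrtr_ge0|exact: sub_pspan].
Qed.

(** * Directions, cosines and supporting half-spaces *)

Section Separation.
Context (D : set 'cV[R]_n) (D_neq0 : D !=set0)
  (D_nonzero : forall d, D d -> d != 0)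
  (D_dir_closed : closed (direction @` D)).

Lemma direction_neq0 : direction @` D !=set0.
Proof. by have [d Dd] := D_neq0; exists (direction d), d. Qed.

Lemma compact_directions : compact (direction @` D).
Proof.
apply: subclosed_compact compact_sphere _ => // _ [d Dd <-] /=.
by rewrite enorm_direction ?D_nonzero.
Qed.

(** Project the multiple t x of norm s on the hull: v = t x - p is nonzero,
    because the hull lies in the cone pspan D and x does not, and v.e is at most
    v.(t x) on the directions, hence at most s |v|. *)
Lemma approx_separation x s : lspan D x -> ~ pspan D x -> 0 < s ->
  exists w, [/\ enorm w = 1, lspan D w &
    forall e, (direction @` D) e -> dotv w e <= s].
Proof.
move=> Dx nDx s0.
have x0 : x != 0 by apply: contra_notN nDx => /eqP->; exact: pspan0.
pose t := s / enorm x.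
have t0 : 0 < t by rewrite divr_gt0 // enorm_gt0.
have [p pE pmin] := nearest_hull (t *: x) direction_neq0 compact_directions.
have Dp := hull_sub_pspan pE.
pose v := t *: x - p.
have v0 : v != 0.
  apply: contra_notN nDx; rewrite subr_eq0 => /eqP tx.
  have -> : x = t^-1 *: (t *: x) by rewrite scalerA mulVf ?scale1r // gt_eqF.
  by rewrite tx; apply: pspanZ => //; rewrite invr_ge0 ltW.
exists (direction v); split; first exact: enorm_direction.
  apply: lspanZ; apply: lspanD; first exact: lspanZ.
  by apply: lspanN; exact: pspan_sub_lspan.
move=> e Ee.
have ve : dotv v e <= dotv v (t *: x).
  have := pmin e Ee; rewrite -(opprB (t *: x) p) -/v !dotvNl dotvNr opprK.
  rewrite dotvDr dotvNr => h; have := dotv_ge0 v; lra.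
have : dotv (direction v) e <= dotv (direction v) (t *: x).
  by rewrite !dotvZl ler_wpM2l // invr_ge0 sqrtr_ge0.
move/le_trans; apply.
have -> : t *: x = s *: direction x by rewrite scalerA.
rewrite dotvZr ger_pMr //.
by apply: dotv_unit_le1; rewrite enorm_direction.
Qed.

(** The normals given by approx_separation for s > 0 lie in the unit sphere of
    lspan D, which is compact; a cluster point as s tends to 0 satisfies each
    closed condition w.e <= s. *)
Lemma pspan_separation : pspan D <> lspan D ->
  exists w, [/\ enorm w = 1, lspan D w &
    forall e, (direction @` D) e -> dotv w e <= 0].
Proof.
move=> neq.
have [x Dx nDx] : exists2 x, lspan D x & ~ pspan D x.
  apply: contrapT => nex; apply: neq; apply/seteqP.
  split; first exact: pspan_sub_lspan.
  by move=> x Dx; apply: contrapT => nDx; apply: nex; exists x.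
have /choice[w wP] (s : R) : exists w, 0 < s -> [/\ enorm w = 1, lspan D w &
    forall e, (direction @` D) e -> dotv w e <= s].
  have [s0|_] := ltP 0 s; last by exists 0.
  by have [w ?] := approx_separation Dx nDx s0; exists w.
pose K := [set u : 'cV[R]_n | enorm u = 1] `&` lspan D.
have Kc : compact K.
  by apply: compact_closedI; [exact: compact_sphere|exact: closed_lspan].
have wK : \forall s \near (0 : R)^'+, K (w s).
  by near=> s; have [|w1 Dw _] := wP s.
have [u [[u1 Du] uF]] := Kc (w @ (0 : R)^'+) _ wK.
exists u; split=> // e Ee; apply/ler_addgt0Pr => s s0; rewrite add0r.
have cl : closed [set v : 'cV[R]_n | dotv v e <= s].
  apply: (@preimage_closed _ _ (fun v : 'cV[R]_n => dotv v e) [set a | a <= s]).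
    move=> y _; apply: (@continuous_dotv R _ n id (cst e)) => //.
    - by move=> z A.
    - exact: cst_continuous.
  exact: closed_le.
apply: cl; move: uF; rewrite clusterE; apply.
change (\forall r \near (0 : R)^'+, dotv (w r) e <= s); near=> r.
have [|_ _ /(_ e Ee) h] := wP r; first by near: r; exact: nbhs_right_gt.
rewrite /= (le_trans h) // ltW //; near: r; exact: nbhs_right_lt.
Unshelve. all: by end_near. Qed.

Lemma max_cosineE u : max_cosine D u = sup [set dotv u e | e in direction @` D].
Proof.
rewrite /max_cosine image_comp; congr (sup _); apply: eq_imagel => d _ /=.
by rewrite dotv_direction.
Qed.

Lemma le_max_cosine u e : enorm u = 1 -> (direction @` D) e ->
  dotv u e <= max_cosine D u.
Proof.
move=> u1 Ee; rewrite max_cosineE; apply: ub_le_sup; last by exists e.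
exists 1 => _ [_ [d Dd <-] <-].
by rewrite dotv_unit_le1 // enorm_direction // D_nonzero.
Qed.

Lemma max_cosine_le u a : (forall e, (direction @` D) e -> dotv u e <= a) ->
  max_cosine D u <= a.
Proof.
move=> ua; rewrite max_cosineE; apply: ge_sup.
  by have [e Ee] := direction_neq0; exists (dotv u e), e.
by move=> _ [e Ee <-]; exact: ua.
Qed.

(** If the point p of the hull closest to 0 were not 0, the unit vector opposite
    to p would have all its cosines bounded by - |p|. *)
Lemma hull_directions0 :
  (forall u, lspan D u -> enorm u = 1 -> 0 <= max_cosine D u) ->
  convex_hull (direction @` D) 0.
Proof.
move=> ge0.
have [p pE pmin] := min_norm_hull direction_neq0 compact_directions.
have [<-//|p0] := eqVneq p 0.
have Np0 : - p != 0 by rewrite oppr_eq0.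
have : max_cosine D (direction (- p)) <= - (dotv p p / enorm (- p)).
  apply: max_cosine_le => e Ee.
  rewrite dotvZl dotvNl mulrN lerN2 mulrC.
  by rewrite ler_wpM2l ?invr_ge0 ?sqrtr_ge0 // pmin.
have /le_trans h : 0 <= max_cosine D (direction (- p)).
  apply: ge0; last exact: enorm_direction.
  by apply: lspanZ; apply: lspanN; apply: pspan_sub_lspan;
    exact: hull_sub_pspan.
by move/h; rewrite oppr_ge0 leNgt divr_gt0 ?enorm_gt0 ?dotv_gt0.
Qed.

End Separation.

(** Each d j with a positive coefficient can be moved to the other side of the
    relation, which makes - d j a nonnegative combination of the others. *)
Lemma pspan_eq_lspan_relation k (d : 'I_k -> 'cV[R]_n) (c : 'I_k -> R) :
  (forall i, 0 <= c i) -> \sum_i c i *: d i = 0 ->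
  let V := d @` [set i | 0 < c i] in pspan V = lspan V.
Proof.
move=> c0 cd V; apply: pspan_eq_lspan => _ [j /= cj <-].
have -> : - d j = \sum_(i | i != j) ((c j)^-1 * c i) *: d i.
  under eq_bigr => i _ do rewrite -scalerA.
  rewrite -scaler_sumr; move/eqP: cd; rewrite (bigD1 j) //= addrC addr_eq0.
  by move/eqP->; rewrite scalerN scalerA mulVf ?scale1r // gt_eqF.
apply: pspan_sum => i _; have := c0 i; rewrite le_eqVlt => /orP[/eqP<-|ci].
  by rewrite mulr0 scale0r; exact: pspan0.
apply: pspanZ; first by rewrite mulr_ge0 // invr_ge0 ltW.
by apply: sub_pspan; exists i.
Qed.

End Spans.

(** * Cosine measure zero *)

Theorem theorem28 (R : realType) (n : nat) (D : set 'cV[R]_n)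
    (D_neq0 : D !=set0)
    (D_closed : closed D)
    (D_dir_closed : closed (direction @` D))
    (D_nonzero : forall d, D d -> d != 0)
    (D_pspan : pspan D <> lspan D) :
  is_cosine_measure D 0 <->
  exists V : set 'cV[R]_n,
    [/\ V !=set0, finite_set V, V `<` D & pspan V = lspan V].
Proof.
split=> [[_ lb]|[V [[v Vv] _ VD VE]]].
- have [k [e [c [Ee [c0 c1] e0]]]] : convex_hull (direction @` D) 0.
    apply: hull_directions0 => // u Du u1; apply: lb; by exists u.
  have /choice[d dE] i : exists d, D d /\ direction d = e i.
    by have [d Dd <-] := Ee i; exists d.
  pose b i := c i / enorm (d i).
  have d0 i : 0 < enorm (d i) by rewrite enorm_gt0 D_nonzero //; case: (dE i).
  have b0 i : 0 <= b i by rewrite divr_ge0 ?c0 // ltW.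
  have bd : \sum_i b i *: d i = 0.
    by rewrite [RHS]e0; apply: eq_bigr => i _; rewrite -(dE i).2 scalerA.
  have VE := pspan_eq_lspan_relation b0 bd; set V := d @` _ in VE.
  have VD : V `<=` D by move=> _ [i _ <-]; case: (dE i).
  exists V; split=> //.
  + apply: contrapT => V0.
    have cz i : c i = 0.
      apply/eqP; rewrite eq_le c0 andbT leNgt; apply/negP => ci.
      by apply: V0; exists (d i), i => //=; rewrite divr_gt0.
    by move: c1; rewrite big1 // => /eqP; rewrite eq_sym oner_eq0.
  + exact: finite_image.
  + by split=> // DV; apply: D_pspan; have <- : V = D by apply/seteqP.
have v0 : v != 0 by apply: D_nonzero; case: VD => + _; exact.
have ge0 u : lspan D u -> enorm u = 1 -> 0 <= max_cosine D u.
  move=> Du u1; rewrite leNgt; apply/negP => lt0.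
  have ud d : V d -> dotv u d < 0.
    move=> Vd; have Dd : D d by case: VD => + _; exact.
    have : dotv u (direction d) < 0.
      by apply: le_lt_trans lt0; apply: le_max_cosine => //; exists d.
    by rewrite dotv_direction pmulr_llt0 // invr_gt0 enorm_gt0 D_nonzero.
  have : pspan V (- v).
    by rewrite VE; apply: lspanN; apply: pspan_sub_lspan; exact: sub_pspan.
  move=> [k [d [c [Vd vE]]]].
  have := ud v Vv; rewrite -oppr_gt0 -dotvNr vE dotv_sumr ltNge => /negP; apply.
  apply: sumr_le0 => i _; case: (Vd i) => Vi ci.
  by rewrite mulr_ge0_le0 // ltW // ud.
have [w [w1 Dw wE]] := pspan_separation D_neq0 D_nonzero D_dir_closed D_pspan.
split.
- exists w; first by split.
  by apply/eqP; rewrite eq_le ge0 // andbT; apply: max_cosine_le.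
- by move=> _ [u [Du u1] <-]; exact: ge0.
Qed.
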